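(* Let $q=5^d$, where $d\ge 1$ is an integer. Let $m_q$ and $n_q$ denote, respectively, the number of quadruples $\{\alpha-1,\alpha,\alpha+1,\alpha+2\}$ (with $\alpha\in\mathbb{F}_q$) of consecutive elements of $\mathbb{F}_q$ that are all non-zero squares, respectively all non-squares. Let $s$ be the integer uniquely determined by the conditions that $q=s^2+t^2$ for some integer $t$, $5\nmid s$, and $s\equiv 1\pmod 4$. If $d$ is even, then $$m_q=\frac{q-10s-39}{16},\qquad n_q=\frac{q+6s-7}{16}.$$ If $d$ is odd, then $$m_q=n_q=\frac{q+2s-7}{16}.$$
   Context: $\mathbb{F}_q$ denotes the finite field of order $q$. A non-zero square is an element of the form $\beta^2$ with $\beta\in\mathbb{F}_q$, $\beta\neq 0$; a non-square is an element of $\mathbb{F}_q$ that is not of the form $\beta^2$ with $\beta\in\mathbb{F}_q$ (so $0$ is neither). The number of quadruples is counted as the number of $\alpha\in\mathbb{F}_q$ for which $\alpha-1,\alpha,\alpha+1,\alpha+2$ all have the stated property. *)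

(* Defs.v *)
From HB Require Import structures.
From mathcomp Require Import all_boot all_order all_algebra.

Set Implicit Arguments.
Unset Strict Implicit.
Unset Printing Implicit Defensive.

Import GRing.Theory.
Local Open Scope ring_scope.

Definition nonzero_square (F : finFieldType) (x : F) : bool :=
  [exists b : F, (b != 0) && (x == b ^+ 2)].

Definition nonsquare (F : finFieldType) (x : F) : bool :=
  ~~ [exists b : F, x == b ^+ 2].

Definition nb_quadruples (F : finFieldType) (P : pred F) : nat :=
  #|[set a : F | [&& P (a - 1), P a, P (a + 1) & P (a + 2)]]|.

Definition m_ (F : finFieldType) : nat := nb_quadruples (@nonzero_square F).
Definition n_ (F : finFieldType) : nat := nb_quadruples (@nonsquare F).

Definition s_spec (q : nat) (s : int) : Prop :=
  [/\ exists t : int, q%:Z = s ^+ 2 + t ^+ 2,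
      ~~ (5 %| s)%Z
    & (s = 1 %[mod 4])%Z].

(* Main.v *)
Require Import Defs.
From HB Require Import structures.
From mathcomp Require Import all_boot all_order all_algebra.
From mathcomp Require Import cyclic finfield.
From mathcomp Require Import zify ring.

Set Implicit Arguments.
Unset Strict Implicit.
Unset Printing Implicit Defensive.

Import Order.TTheory GRing.Theory Num.Theory.
Local Open Scope ring_scope.

(** Let chi be the quadratic character of F, with values 0, 1, -1 in the
    integers, and let f_i = chi (a + i). Away from the four a for which some
    f_i vanishes, 16 times the indicator of f_{-1} = f_0 = f_1 = f_2 = e
    (where e = 1 or -1) is the product of the factors 1 + e f_i
    (`indicator_sign`). Summing the expanded product over F gives q from the
    empty subset, 0 from the singletons, -1 from each of the 6 pairs
    (`sum_quad_char_pair`), and character sums of cubics and of one quartic.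
    In characteristic 5 the set {a-1, a, a+1, a+2} misses only one element of
    a + F_5, and this forces a coincidence: by an affine change of variable
    every cubic becomes x^3 - x up to a scalar, so that its sum is E or
    chi(2) E, where E = sum_x chi(x^3 - x); the quartic becomes such a cubic
    once one of its rational roots is sent to infinity, and its sum is E - 1
    (`sum_quartic`). Hence m_q and n_q are explicit in terms of E and chi(2)
    (`count_quadruples`), and chi(2) = (-1)^d.

    It remains to see that E = 2 (-1)^(d+1) s (`jacobsthal1_s_spec`). Here
    E = J(1) is a value of the Jacobsthal sum J(n) = sum_x chi(x (x^2 - n)).
    - As J(b^2 n) = chi(b) J(n), the integer J(n)^2 only depends on the square
      class of n, and evaluating the second moment of J gives
      J(1)^2 + J(g)^2 = 4 q for every non-square g, because -1 = 2^2 is a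
      square (`jacobsthal_sum_two_squares`); so q = (E/2)^2 + t^2.
    - The symmetries x -> -x and x -> 1/x of chi(x^3 - x) give E modulo 8,
      whence the sign (`jacobsthal1_mod8`).
    - By Euler's criterion E is, up to sign, the Hasse invariant of
      y^2 = x^3 - x modulo 5, that is, a central binomial coefficient
      (`jacobsthal1_natr`), which is prime to 5 (`central_bin_ndvd5`).
    Thus the field F itself supplies the integer s, and its uniqueness is the
    elementary uniqueness of representations of 5^d as a sum of two squares
    prime to 5 (`s_spec_uniq`). *)

(** * The quadratic character *)

Lemma finField_prim_root (F : finFieldType) :
  exists g : F, (#|F|.-1).-primitive_root g.
Proof.
have F1 : (1 < #|F|)%N := finNzRing_gt1 F.
have : has (#|F|.-1).-primitive_root (enum [pred x : F | x != 0]).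
  apply: has_prim_root.
  - by lia.
  - apply/allP => x; rewrite mem_enum inE => x0.
    apply/unity_rootP; apply: (mulfI x0).
    by rewrite -exprS prednK ?expf_card ?mulr1 //; lia.
  - exact: enum_uniq.
  - rewrite -cardE -(cardC1 (0 : F)); apply: subset_leq_card.
    by apply/subsetP => x; rewrite !inE.
by case/hasP => g _ gP; exists g.
Qed.

Definition quad_char (F : finFieldType) (x : F) : int :=
  if x == 0 then 0 else if nonzero_square x then 1 else -1.

(* The order of F is odd; N is the exponent of Euler's criterion. *)
Section QuadraticCharacter.
Variables (F : finFieldType) (N : nat).
Hypothesis cardF : #|F| = N.*2.+1.

Local Notation chi := (@quad_char F).

Lemma half_order_gt0 : (0 < N)%N.
Proof. by have := finNzRing_gt1 F; rewrite cardF; case: N. Qed.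

Lemma sqrf_half_order (x : F) : x != 0 -> (x ^+ N) ^+ 2 = 1.
Proof.
move=> x0; rewrite -exprM muln2; apply: (mulfI x0).
by rewrite -exprS -cardF expf_card mulr1.
Qed.

Lemma generatorP (g : F) : (#|F|.-1).-primitive_root g ->
  forall x, x != 0 -> exists i, x = g ^+ i.
Proof.
move=> gP x x0; have [] := prim_rootP gP (x := x).
  by rewrite cardF /= -muln2 exprM sqrf_half_order.
by move=> i ->; exists i.
Qed.

(** The order of F being odd, its characteristic is not 2: for a generator g,
    g^N squares to 1 without being 1. *)
Lemma oppr1_neq1 : -1 != 1 :> F.
Proof.
have [g gP] := finField_prim_root F.
have : g ^+ N != 1.
  rewrite -(prim_order_dvd gP) cardF /=; apply/negP => /dvdn_leq.
  by have := half_order_gt0; lia.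
apply: contra => /eqP e; have : g ^+ N ^+ 2 = 1.
  apply: sqrf_half_order; apply/eqP => g0.
  have := prim_expr_order gP; rewrite g0 expr0n cardF /= double_eq0.
  by case: eqP half_order_gt0 => [-> //|_ _ /eqP]; rewrite eq_sym oner_eq0.
by move/eqP; rewrite sqrf_eq1 e orbb.
Qed.

Lemma generator_neq0 (g : F) : (#|F|.-1).-primitive_root g -> g != 0.
Proof.
move=> gP; apply/eqP => g0; have := prim_expr_order gP.
rewrite g0 expr0n cardF /= double_eq0.
by case: eqP half_order_gt0 => [-> //|_ _ /eqP]; rewrite eq_sym oner_eq0.
Qed.

Lemma generator_half_order (g : F) :
  (#|F|.-1).-primitive_root g -> g ^+ N = -1.
Proof.
move=> gP; have /eqP := sqrf_half_order (generator_neq0 gP).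
rewrite sqrf_eq1 => /orP[|/eqP //].
rewrite -(prim_order_dvd gP) cardF /= => /dvdn_leq.
by have := half_order_gt0; lia.
Qed.

(** A power g^i of a generator is a square when i is even, and g^N = -1. *)
Lemma euler_criterion (x : F) : x != 0 ->
  x ^+ N = if nonzero_square x then 1 else -1.
Proof.
move=> x0; case: ifPn => [/existsP[b /andP[b0 /eqP->]]|nsq].
  by rewrite exprAC sqrf_half_order.
have [g gP] := finField_prim_root F.
have [i xE] := generatorP gP x0.
suff : odd i.
  by move=> oi; rewrite xE exprAC (generator_half_order gP) -signr_odd oi.
apply: contraR nsq => ei; apply/existsP; exists (g ^+ i./2).
by rewrite expf_neq0 ?(generator_neq0 gP) //= -exprM muln2 even_halfK // xE.
Qed.

Lemma quad_charE (x : F) : (chi x)%:~R = x ^+ N :> F.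
Proof.
rewrite /quad_char; case: eqP => [->|/eqP x0].
  by rewrite expr0n; case: eqP half_order_gt0 => // ->.
by rewrite euler_criterion //; case: ifP.
Qed.

(** The identities of chi that hold in F by Euler's criterion lift to the
    integers because 0, 1 and -1 remain distinct in F. *)
Lemma sign_intr_inj (a b : int) : a \in [:: 0; 1; -1] -> b \in [:: 0; 1; -1] ->
  a%:~R = b%:~R :> F -> a = b.
Proof.
have n10 := oner_eq0 F; have m1 := negbTE oppr1_neq1.
have n1m : (-1 == 0 :> F) = false by rewrite oppr_eq0.
rewrite !inE; move=> /or3P[]/eqP-> /or3P[]/eqP-> // /eqP;
  by rewrite ?mulrNz ?mulr1z ?mulr0z ?[0 == _]eq_sym ?[1 == -1]eq_sym
     ?n10 ?m1 ?n1m.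
Qed.

Lemma quad_char_sign (x : F) : chi x \in [:: 0; 1; -1].
Proof. by rewrite /quad_char; case: ifP => // _; case: ifP. Qed.

Lemma quad_char_uniq (x : F) (a : int) :
  a \in [:: 0; 1; -1] -> x ^+ N = a%:~R -> chi x = a.
Proof.
move=> ha xE; apply: sign_intr_inj => //; first exact: quad_char_sign.
by rewrite quad_charE.
Qed.

Lemma quad_charM (x y : F) : chi (x * y) = chi x * chi y.
Proof.
apply: quad_char_uniq; last by rewrite rmorphM /= !quad_charE exprMn.
by have := quad_char_sign x; have := quad_char_sign y; rewrite !inE;
  move=> /or3P[]/eqP-> /or3P[]/eqP->.
Qed.

Lemma quad_char0 : chi 0 = 0. Proof. by rewrite /quad_char eqxx. Qed.

Lemma quad_char_eq0 (x : F) : (chi x == 0) = (x == 0).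
Proof. by rewrite /quad_char; case: (x =P 0) => // _; case: ifP. Qed.

Lemma quad_char_sqr (x : F) : x != 0 -> chi x ^+ 2 = 1.
Proof. by rewrite /quad_char => /negbTE->; case: ifP. Qed.

Lemma quad_charX2 (x : F) : x != 0 -> chi (x ^+ 2) = 1.
Proof. by move=> x0; rewrite expr2 quad_charM -expr2 quad_char_sqr. Qed.

Lemma quad_char1 : chi 1 = 1.
Proof. by rewrite -(expr1n _ 2) quad_charX2 ?oner_eq0. Qed.

Lemma quad_charV (x : F) : chi x^-1 = chi x.
Proof.
have [->|x0] := eqVneq x 0; first by rewrite invr0.
apply: (@mulfI _ (chi x)); first by rewrite quad_char_eq0.
by rewrite -quad_charM divff // quad_char1 -expr2 quad_char_sqr.
Qed.

Lemma quad_char_generator (g : F) : (#|F|.-1).-primitive_root g -> chi g = -1.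
Proof. by move=> gP; apply: quad_char_uniq => //; rewrite generator_half_order. Qed.

(** * Sums of the character over quadratic polynomials *)

Lemma sum_translate (c : F) (f : F -> int) : \sum_x f (x + c) = \sum_x f x.
Proof. by rewrite [in RHS](reindex_inj (@addIr F c)). Qed.

Lemma sum_scale (c : F) (f : F -> int) : c != 0 -> \sum_x f (c * x) = \sum_x f x.
Proof. by move=> c0; rewrite [in RHS](reindex_inj (mulfI c0)). Qed.

(** Scaling by a generator g, for which chi g = -1, negates the sum. *)
Lemma sum_quad_char : \sum_(x : F) chi x = 0.
Proof.
have [g gP] := finField_prim_root F.
have := sum_scale chi (generator_neq0 gP).
under eq_bigr do rewrite quad_charM quad_char_generator // mulN1r.
by rewrite sumrN; move: (\sum_x chi x) => s; lia.
Qed.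

Lemma sum_inverse (f : F -> int) : \sum_(x | x != 0) f x^-1 = \sum_(x | x != 0) f x.
Proof.
rewrite [in RHS](reindex_inj invr_inj).
by apply: eq_bigl => x; rewrite invr_eq0.
Qed.

Lemma sum_nonzero (f : F -> int) : \sum_(x | x != 0) f x = \sum_x f x - f 0.
Proof. by rewrite [in RHS](bigD1 (0 : F)) //= addrC addrK. Qed.

(** For x <> 0, x (x + c) is a square times 1 + c/x, and 1 + c/x takes
    every value but 1 when c <> 0. *)
Lemma sum_quad_char_quadratic (c : F) :
  \sum_x chi (x * (x + c)) = if c == 0 then N.*2%:Z else -1.
Proof.
have -> : \sum_x chi (x * (x + c)) = \sum_(x | x != 0) chi (x^-1 * c + 1).
  rewrite (bigD1 (0 : F)) //= mul0r quad_char0 add0r; apply: eq_bigr => x x0.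
  have -> : x * (x + c) = x ^+ 2 * (x^-1 * c + 1) by field.
  by rewrite quad_charM quad_charX2 // mul1r.
case: eqP => [->|/eqP c0].
  under eq_bigr do rewrite mulr0 add0r quad_char1.
  by rewrite sumr_const cardC1 cardF natz.
rewrite (sum_inverse (fun y => chi (y * c + 1))) sum_nonzero mul0r add0r.
rewrite quad_char1; under eq_bigr do rewrite mulrC.
rewrite (sum_scale (fun y => chi (y + 1)) c0) sum_translate sum_quad_char.
by rewrite sub0r.
Qed.

Lemma sum_quad_char_pair (a b : F) : a != b ->
  \sum_x (chi (x + a) * chi (x + b)) = -1.
Proof.
move=> ab; have := sum_translate a (fun x => chi (x * (x + (b - a)))).
rewrite sum_quad_char_quadratic subr_eq0 eq_sym (negbTE ab) => <-.
by apply: eq_bigr => x _; rewrite -quad_charM; congr (chi (_ * _)); ring.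
Qed.

(** * Jacobsthal sums *)

Definition jacobsthal (n : F) : int := \sum_x chi (x * (x ^+ 2 - n)).

(** Substitute b x for x. *)
Lemma jacobsthal_scale (b n : F) : b != 0 ->
  jacobsthal (b ^+ 2 * n) = chi b * jacobsthal n.
Proof.
move=> b0; rewrite /jacobsthal -(sum_scale _ b0) mulr_sumr; apply: eq_bigr => x _.
rewrite -[RHS]mulr1 -(quad_charX2 b0) -!quad_charM; congr quad_char; ring.
Qed.

Lemma jacobsthal0 : jacobsthal 0 = 0.
Proof.
rewrite -sum_quad_char; apply: eq_bigr => x _; rewrite subr0 -exprS.
have [->|x0] := eqVneq x 0; first by rewrite expr0n.
by rewrite exprS quad_charM quad_charX2 ?mulr1.
Qed.

(** Expand the square and sum over n first: the inner sum runs over a quadratic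
    polynomial in n with roots x^2 and y^2, and is q - 1 if y = x or y = -x,
    and -1 otherwise. *)
Lemma sum_jacobsthal_sqr : chi (-1) = 1 ->
  \sum_n jacobsthal n ^+ 2 = 2 * #|F|%:Z * (#|F|%:Z - 1).
Proof.
move=> chiN1.
have chiN (x : F) : chi (- x) = chi x by rewrite -mulN1r quad_charM chiN1 mul1r.
have -> : \sum_n jacobsthal n ^+ 2 =
    \sum_x \sum_y chi x * chi y * \sum_n chi ((n - x ^+ 2) * (n - y ^+ 2)).
  transitivity (\sum_n \sum_x \sum_y
      chi x * chi y * chi ((n - x ^+ 2) * (n - y ^+ 2))).
    apply: eq_bigr => n _; rewrite expr2 /jacobsthal mulr_suml.
    apply: eq_bigr => x _; rewrite mulr_sumr; apply: eq_bigr => y _.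
    rewrite !quad_charM -[n - x ^+ 2]opprB -[n - y ^+ 2]opprB !chiN; ring.
  rewrite exchange_big; apply: eq_bigr => x _; rewrite exchange_big.
  by apply: eq_bigr => y _; rewrite mulr_sumr.
have inner (x y : F) : \sum_n chi ((n - x ^+ 2) * (n - y ^+ 2)) =
    (if y ^+ 2 == x ^+ 2 then #|F|%:Z else 0) - 1.
  have := sum_translate (- x ^+ 2) (fun n => chi (n * (n + (x ^+ 2 - y ^+ 2)))).
  rewrite sum_quad_char_quadratic subr_eq0 eq_sym => e.
  transitivity (if y ^+ 2 == x ^+ 2 then N.*2%:Z else -1).
    by rewrite -e; apply: eq_bigr => n _; congr chi; ring.
  by rewrite cardF; case: ifP => _; lia.
under eq_bigr => x _ do under eq_bigr => y _ do rewrite inner mulrBr mulr1.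
under eq_bigr => x _ do rewrite sumrB -mulr_sumr sum_quad_char mulr0 subr0.
rewrite (bigD1 (0 : F)) //= big1 ?add0r; last first.
  by move=> y _; rewrite quad_char0 !mul0r.
transitivity (\sum_(x : F | x != 0) 2 * #|F|%:Z).
  apply: eq_bigr => x x0.
  have xNx : - x != x.
    rewrite -mulN1r -[X in _ != X]mul1r.
    by apply: contra oppr1_neq1 => /eqP/(mulIf x0)->.
  rewrite (bigD1 x) //= (bigD1 (- x)) //= big1 ?addr0; last first.
    move=> y /andP[yx yNx]; rewrite eqf_sqr (negbTE yx) (negbTE yNx).
    by rewrite mulr0.
  by rewrite sqrrN eqxx chiN -expr2 quad_char_sqr //; ring.
rewrite sumr_const cardC1 cardF /= -mulr_natr natz; ring.
Qed.

(** J(n)^2 is A = J(1)^2 on the non-zero squares and B = J(g)^2 on the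
    non-squares. Writing 2 J(n)^2 = (A + B) + chi(n) (A - B) makes the second
    moment of J equal to (q - 1) (A + B) / 2, without counting squares. *)
Lemma jacobsthal_sum_two_squares (g : F) : chi (-1) = 1 -> chi g = -1 ->
  jacobsthal 1 ^+ 2 + jacobsthal g ^+ 2 = 4 * #|F|%:Z.
Proof.
move=> chiN1 chig; set A := _ ^+ 2; set B := _ ^+ 2.
have g0 : g != 0 by rewrite -quad_char_eq0 chig.
have JE (n : F) : n != 0 ->
    2 * jacobsthal n ^+ 2 = (A + B) + chi n * (A - B).
  have sq (m : F) : m != 0 -> chi m = 1 -> exists2 b : F, b != 0 & m = b ^+ 2.
    rewrite /quad_char => /negbTE->; case: ifP => // /existsP[b /andP[b0 /eqP->]] _.
    by exists b.
  move=> n0; have : chi n == 1 \/ chi n == -1.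
    by have := quad_char_sign n; rewrite !inE quad_char_eq0 (negbTE n0) /= => /orP.
  case=> /eqP chin; rewrite chin.
    have [b b0 nE] := sq n n0 chin.
    rewrite -[n]mulr1 nE jacobsthal_scale // exprMn quad_char_sqr //.
    by rewrite -/A; ring.
  have [||b b0 nE] := sq (n / g).
  - by rewrite mulf_neq0 ?invr_eq0.
  - by rewrite quad_charM quad_charV chin chig.
  rewrite -[n](divfK g0) nE jacobsthal_scale // exprMn quad_char_sqr //.
  by rewrite -/B; ring.
have : \sum_(n : F | n != 0) 2 * jacobsthal n ^+ 2 =
       \sum_(n : F | n != 0) ((A + B) + chi n * (A - B)) by apply: eq_bigr.
rewrite big_split /= sumr_const cardC1 cardF /= -mulr_suml -mulr_sumr.
rewrite (sum_nonzero (fun n => chi n)) (sum_nonzero (fun n => jacobsthal n ^+ 2)).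
rewrite sum_quad_char quad_char0 jacobsthal0 sum_jacobsthal_sqr // cardF.
have N0 := half_order_gt0; rewrite subrr mul0r => e.
have {}e : (A + B) * N.*2%:Z = 4 * (N.*2.+1)%:Z * N.*2%:Z.
  rewrite -natz mulr_natr -[LHS]addr0 -e; lia.
by apply: mulIf e; lia.
Qed.


(** * Jacobsthal sums in the prime field *)

(** The translation by 1 permutes F, so it preserves the sum of all elements. *)
Lemma card_natr0 : #|F|%:R = 0 :> F.
Proof.
have /eqP : \sum_(x : F) x = \sum_(x : F) (x + 1).
  by rewrite [in LHS](reindex_inj (@addIr F 1)).
rewrite big_split /= sumr_const -subr_eq0 opprD addrA subrr sub0r oppr_eq0.
by move/eqP.
Qed.

Lemma power_sum (j : nat) : (0 < j)%N ->
  \sum_(x : F) x ^+ j = if (N.*2 %| j)%N then -1 else 0.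
Proof.
move=> j0; have [g gP] := finField_prim_root F.
have -> : (N.*2 %| j)%N = (g ^+ j == 1).
  by rewrite -(prim_order_dvd gP) cardF.
case: (g ^+ j =P 1) => [gj1|/eqP gj1].
  rewrite (bigD1 0) //= expr0n gtn_eqF // add0r.
  transitivity (\sum_(x : F | x != 0) (1 : F)).
    apply: eq_bigr => x x0; have [i ->] := generatorP gP x0.
    by rewrite exprAC gj1 expr1n.
  have /eqP := card_natr0; rewrite cardF -addn1 natrD addr_eq0 => /eqP <-.
  by rewrite sumr_const cardC1 cardF.
apply/eqP; have g0 := generator_neq0 gP.
have : \sum_(x : F) x ^+ j = g ^+ j * \sum_(x : F) x ^+ j.
  rewrite [in LHS](reindex_inj (mulfI g0)) mulr_sumr.
  by apply: eq_bigr => x _; rewrite exprMn.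
move/eqP; rewrite -subr_eq0 -{1}[\sum_x _]mul1r -mulrBl mulf_eq0 subr_eq0.
by rewrite eq_sym (negbTE gj1).
Qed.

(** This is the Hasse invariant of y^2 = x^3 - x. By Euler's criterion the sum is
    that of x^N (x^2 - 1)^N; after expansion the exponents lie between N and
    3N, and the only multiple of q - 1 = 2N among them comes from the middle
    binomial coefficient. *)
Lemma jacobsthal1_natr (M : nat) : N = M.*2 ->
  (jacobsthal 1)%:~R = - ((-1) ^+ M * 'C(M.*2, M)%:R) :> F.
Proof.
move=> NM; have N0 := half_order_gt0.
rewrite /jacobsthal rmorph_sum /=.
transitivity (\sum_(i < N.+1) (-1) ^+ i * 'C(N, i)%:R *
    \sum_(x : F) x ^+ (N + (N - i).*2)).
  transitivity (\sum_(x : F) \sum_(i < N.+1) (-1) ^+ i * 'C(N, i)%:R *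
      x ^+ (N + (N - i).*2)).
    apply: eq_bigr => x _; rewrite quad_charE exprMn exprBn mulr_sumr.
    apply: eq_bigr => i _; rewrite expr1n mulr1 exprD -mul2n exprM.
    by rewrite -mulr_natr; ring.
  by rewrite exchange_big; apply: eq_bigr => i _; rewrite mulr_sumr.
have Mlt : (M < N.+1)%N by lia.
rewrite (bigD1 (Ordinal Mlt)) //= [X in _ + X]big1 ?addr0 => [|i iM].
  rewrite power_sum; last by lia.
  have -> : (N + (N - M).*2 = N.*2)%N by lia.
  by rewrite dvdnn NM mulrN1.
have {}iM : (i != M :> nat) by apply: contra iM => /eqP e; apply/eqP/val_inj.
rewrite power_sum; last by lia.
case: ifP => [/dvdnP[k]|]; last by rewrite mulr0.
have := ltn_ord i; case: k => [|[|k]]; nia.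
Qed.

(** * Jacobsthal sums in characteristic 5 *)

Hypothesis char5 : 5%:R = 0 :> F.

Lemma neq0_F5 (k : nat) : ~~ (5 %| k)%N -> k%:R != 0 :> F.
Proof.
have p5 : 5 \in [pchar F] by rewrite inE char5 eqxx.
by rewrite (dvdn_pcharf p5).
Qed.

Lemma quad_charN1 : chi (-1) = 1.
Proof.
have -> : -1 = 2 ^+ 2 :> F.
  by apply/esym/eqP; rewrite -subr_eq0 -char5; apply/eqP; ring.
by rewrite quad_charX2 ?(@neq0_F5 2).
Qed.

Lemma quad_charN (x : F) : chi (- x) = chi x.
Proof. by rewrite -mulN1r quad_charM quad_charN1 mul1r. Qed.

(** The value chi(x^3 - x) is invariant under the four-group generated by
    x -> -x and x -> 1/x. This group acts freely outside the five points 0, 1, -1, 2, -2,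
    at which the value is never -1, and its orbits are there the fibres of
    x^2 + x^-2. *)
Lemma card_minus_fibres :
  (4 %| #|[set x : F | chi (x * (x ^+ 2 - 1))%R == -1%R]|)%N.
Proof.
set A := [set x | _]; pose phi (x : F) := x ^+ 2 + x^-1 ^+ 2.
have n2 := @neq0_F5 2 isT.
rewrite -sum1_card (partition_big phi predT) //=; apply: dvdn_sum => w _.
rewrite sum1dep_card; set B := [set x | _].
have [->|[a]] := set_0Vmem B; first by rewrite cards0.
rewrite !inE => /andP[aA /eqP wE]; rewrite {}/B -{w}wE; set B := [set x | _].
have a0 : a != 0 by apply: contraTneq aA => ->; rewrite mul0r quad_char0.
have a1 : a ^+ 2 != 1.
  by apply: contraTneq aA => ->; rewrite subrr mulr0 quad_char0.
have a2 : a ^+ 2 != -1.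
  apply: contraTneq aA => e; rewrite e.
  have : (a - 2) * (a + 2) = 0.
    by transitivity (a ^+ 2 + 1 - 5%:R); [ring | rewrite char5 e; ring].
  move/eqP; rewrite mulf_eq0 subr_eq0 addr_eq0 => /orP[]/eqP->.
    have -> : 2 * (-1 - 1) = 1 - 5%:R :> F by ring.
    by rewrite char5 subr0 quad_char1.
  have -> : - 2 * (-1 - 1) = 5%:R - 1 :> F by ring.
  by rewrite char5 sub0r quad_charN1.
have av0 : a^-1 != 0 by rewrite invr_eq0.
have aNa (x : F) : x != 0 -> (x == - x) = false.
  by move=> x0; rewrite -addr_eq0 -mulr2n -mulr_natl mulf_eq0 (negbTE n2) (negbTE x0).
have aV : (a == a^-1) = false.
  by apply: contra_neqF a1 => /eqP e; rewrite expr2 {2}e divff.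
have aNV : (a == - a^-1) = false.
  by apply: contra_neqF a2 => /eqP e; rewrite expr2 {2}e mulrN divff.
have U : uniq [:: a; - a; a^-1; - a^-1].
  by rewrite /= !inE !negb_or aNa // aV aNV aNa // eqr_oppLR aNV eqr_opp aV.
suff -> : #|B| = #|[:: a; - a; a^-1; - a^-1]| by rewrite (card_uniqP U).
apply: eq_card => x; rewrite !inE; apply/andP/idP.
  case=> xA /eqP e.
  have x0 : x != 0 by apply: contraTneq xA => ->; rewrite mul0r quad_char0.
  have : (x - a) * (x + a) * ((x - a^-1) * (x + a^-1)) = 0.
    transitivity (x ^+ 2 * (phi x - phi a)); last by rewrite e subrr mulr0.
    by rewrite /phi; field; rewrite a0.
  move/eqP; rewrite !mulf_eq0 !subr_eq0 !addr_eq0.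
  by case/orP => /orP[]->; rewrite ?orbT.
(* Conversely, the whole orbit of a lies in the set. *)
have GN (y : F) : chi (- y * ((- y) ^+ 2 - 1)) = chi (y * (y ^+ 2 - 1)).
  by rewrite sqrrN mulNr quad_charN.
have GV : chi (a^-1 * (a^-1 ^+ 2 - 1)) = chi (a * (a ^+ 2 - 1)).
  have -> : a^-1 * (a^-1 ^+ 2 - 1) = - (a^-1 ^+ 2 ^+ 2 * (a * (a ^+ 2 - 1))).
    by field.
  by rewrite quad_charN quad_charM quad_charX2 ?mul1r // expf_neq0.
have phiN y : phi (- y) = phi y by rewrite /phi invrN !sqrrN.
have phiV : phi a^-1 = phi a by rewrite /phi invrK addrC.
by case/or4P => /eqP->; rewrite ?GN ?GV ?phiN ?phiV.
Qed.

(** The character vanishes on x^3 - x exactly at 0, 1, -1, so that E is q - 3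
    minus twice the number of x with value -1. *)
Lemma jacobsthal1_mod8 :
  exists k : nat, jacobsthal 1 = #|F|%:Z - 3 - 8 * k%:Z.
Proof.
have /dvdnP[k kE] := card_minus_fibres; exists k.
set A := [set x | _] in kE.
have n2 := @neq0_F5 2 isT.
have n1 := oner_eq0 F.
suff : \sum_(x : F) (1 - chi (x * (x ^+ 2 - 1))) = 3 + 2 * #|A|%:Z.
  rewrite sumrB kE -/(jacobsthal 1).
  have -> : \sum_(x : F) (1 : int) = #|F|%:Z by rewrite sumr_const natz.
  move=> e.
  by move: e; move: (jacobsthal 1) => J; lia.
have U : uniq [:: (0 : F); 1; -1].
  by rewrite /= !inE eq_sym n1 eq_sym oppr_eq0 n1 eq_sym oppr1_neq1.
transitivity (\sum_(x : F) ((x \in [:: 0; 1; -1])%:Z + 2 * (x \in A)%:Z)).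
  apply: eq_bigr => x _; rewrite /A !inE.
  have [->|x0] := eqVneq x 0; first by rewrite mul0r quad_char0.
  have [->|x1] := eqVneq x 1; first by rewrite expr1n subrr mulr0 quad_char0.
  have [->|x2] := eqVneq x (-1).
    by rewrite sqrrN expr1n subrr mulr0 quad_char0.
  have := quad_char_sign (x * (x ^+ 2 - 1)).
  rewrite !inE quad_char_eq0 mulf_eq0 (negbTE x0) subr_eq0 sqrf_eq1.
  rewrite (negbTE x1) (negbTE x2) /=.
  by case/orP => /eqP->.
rewrite big_split /= -mulr_sumr.
have card_sum (P : pred F) : \sum_(x : F) (P x)%:Z = #|P|%:Z.
  rewrite -sum1_card -natz natr_sum [RHS]big_mkcond /=.
  by apply: eq_bigr => x _; rewrite unfold_in; case: (P x).
by rewrite (card_sum (mem [:: 0; 1; -1])) (card_sum (mem A)) (card_uniqP U).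
Qed.

(** Here 2 is a square root of -1. *)
Lemma quad_char2 (M : nat) : N = M.*2 -> chi 2 = (-1) ^+ M.
Proof.
move=> NM; apply: quad_char_uniq.
  by rewrite -signr_odd; case: (odd M).
rewrite NM -mul2n exprM.
have -> : 2 ^+ 2 = -1 :> F.
  by apply/eqP; rewrite -subr_eq0 -char5; apply/eqP; ring.
by rewrite rmorphXn rmorphN1.
Qed.

Lemma jacobsthal4 : jacobsthal (2 ^+ 2) = chi 2 * jacobsthal 1.
Proof. by rewrite -jacobsthal_scale ?mulr1 ?(@neq0_F5 2). Qed.

(** Proves identities of F that hold modulo 5, with an explicit quotient k. *)
Lemma eq_modF5 (k x y : F) : x = y + 5%:R * k -> x = y.
Proof. by rewrite char5 mul0r addr0. Qed.

(** * Counting quadruples *)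

(** The form in which the cubics occur: roots c, c + b and c - b, with
    n = b^2. *)
Lemma sum_triple (c n : F) (f : F -> int) :
  (forall x, f x = chi ((x + c) * ((x + c) ^+ 2 - n))) ->
  \sum_x f x = jacobsthal n.
Proof.
move=> fE; rewrite /jacobsthal -(sum_translate c (fun x => chi (x * (x ^+ 2 - n)))).
by apply: eq_bigr => x _; rewrite fE.
Qed.

(** Setting x = 1/u sends the root 0 to infinity: up to the square x^4, the
    quartic becomes (1 - u) (1 + u) (1 + 2u), whose roots are three elements of
    F_5. The term -1 is the value at u = 0, which no x reaches. *)
Lemma sum_quartic :
  \sum_x (chi (x - 1) * chi x * chi (x + 1) * chi (x + 2)) = jacobsthal 1 - 1.
Proof.
pose h (u : F) := chi ((1 - u) * (1 + u) * (1 + 2 * u)).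
transitivity (\sum_(x : F | x != 0) h x^-1).
  rewrite (bigD1 (0 : F)) //= quad_char0 mulr0 !mul0r add0r.
  apply: eq_bigr => x x0; rewrite /h -!quad_charM -[RHS]mul1r.
  rewrite -(@quad_charX2 (x ^+ 2)) ?expf_neq0 // -quad_charM; congr chi.
  by field.
rewrite (sum_inverse h) sum_nonzero; congr (_ - _); last first.
  by rewrite /h subr0 mulr0 !addr0 !mulr1 quad_char1.
(* The roots are 1, -1 and 2, symmetric about -1. *)
rewrite -(sum_translate (-1)) /h.
transitivity (chi (- 2) * jacobsthal (2 ^+ 2)).
  rewrite mulr_sumr; apply: eq_bigr => x _; rewrite -quad_charM; congr chi.
  by apply: (@eq_modF5 (- (x * (2 - x)))); ring.
rewrite quad_charN jacobsthal4 mulrA -expr2 quad_char_sqr ?mul1r //.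
exact: (@neq0_F5 2).
Qed.

(** The zero case is set apart because the product can be non-zero there: it has
    to be subtracted at the four elements a where some term vanishes. *)
Lemma indicator_sign (e a b c d : int) : e \in [:: 1; -1] ->
  a \in [:: 0; 1; -1] -> b \in [:: 0; 1; -1] -> c \in [:: 0; 1; -1] ->
  d \in [:: 0; 1; -1] ->
  16 * [&& a == e, b == e, c == e & d == e]%:Z =
  (if [|| a == 0, b == 0, c == 0 | d == 0] then 0 else
   (1 + e * a) * (1 + e * b) * (1 + e * c) * (1 + e * d)).
Proof.
rewrite !inE => /orP[]/eqP-> /or3P[]/eqP-> /or3P[]/eqP-> /or3P[]/eqP->
  /or3P[]/eqP-> //.
Qed.

(** The linear term in e comes from the four triples, two of which
    consist of consecutive elements of a + F_5 (sum E) and two of which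
    do not (sum chi(2) E). The last line is the contribution of
    a = 1, 0, -1, -2. *)
Lemma count_quadruples (e : int) : e \in [:: 1; -1] ->
  16 * #|[set a : F | [&& chi (a - 1)%R == e, chi a == e, chi (a + 1)%R == e
                       & chi (a + 2)%R == e]]|%:Z =
  #|F|%:Z - 7 + (1 + 2 * e * (1 + chi 2)) * jacobsthal (1 : F)
  - 2 * (1 + e) * (1 + e * chi 2) * (2 + e + e * chi 2).
Proof.
move=> eP.
pose P (a : F) := (1 + e * chi (a - 1)) * (1 + e * chi a) *
  (1 + e * chi (a + 1)) * (1 + e * chi (a + 2)).
pose s := [:: (1 : F); 0; -1; -2].
have n1 := oner_neq0 F; have n2 := @neq0_F5 2 isT; have n3 := @neq0_F5 3 isT.
have sU : uniq s.
  rewrite /= !inE !negb_or -!addr_eq0 !add0r.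
  have -> : 1 + 1 = 2 :> F by ring.
  have -> : 1 + 2 = 3 :> F by ring.
  have -> : -1 + 2 = 1 :> F by ring.
  by rewrite n1 n2 n3.
have -> : 16 * #|[set a : F | [&& chi (a - 1)%R == e, chi a == e,
    chi (a + 1)%R == e & chi (a + 2)%R == e]]|%:Z =
    \sum_(a : F) (P a - if a \in s then P a else 0).
  rewrite -sum1_card -natz natr_sum big_mkcond /= mulr_sumr.
  apply: eq_bigr => a _; rewrite inE.
  have := indicator_sign eP (quad_char_sign (a - 1)) (quad_char_sign a)
    (quad_char_sign (a + 1)) (quad_char_sign (a + 2)).
  rewrite !quad_char_eq0 subr_eq0 !addr_eq0 !inE -/(P a).
  by case: [&& _, _, _ & _]; case: [|| _, _, _ | _] => // <-; rewrite ?subr0 ?subrr.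
rewrite sumrB -big_mkcond -big_uniq //= !big_cons big_nil.
have [chi3 chiN3 chiN2] :
    [/\ chi 3 = chi 2, chi (-3) = chi 2 & chi (-2) = chi 2].
  rewrite !quad_charN; have -> : 3 = - 2 :> F by apply: (@eq_modF5 1); ring.
  by rewrite quad_charN.
have PE (a : F) : P a = 1 + e * (chi (a - 1) + chi a + chi (a + 1) + chi (a + 2)) +
   (chi (a - 1) * chi a + chi (a - 1) * chi (a + 1) + chi (a - 1) * chi (a + 2) +
    chi a * chi (a + 1) + chi a * chi (a + 2) + chi (a + 1) * chi (a + 2)) +
   e * (chi (a - 1) * chi a * chi (a + 1) + chi (a - 1) * chi a * chi (a + 2) +
    chi (a - 1) * chi (a + 1) * chi (a + 2) + chi a * chi (a + 1) * chi (a + 2)) +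
   chi (a - 1) * chi a * chi (a + 1) * chi (a + 2).
  rewrite /P; move: (chi (a - 1)) (chi a) (chi (a + 1)) (chi (a + 2)).
  by move: eP => + w x y z; rewrite !inE => /orP[]/eqP->; ring.
have sumP : \sum_a P a = #|F|%:Z - 7 + (1 + 2 * e * (1 + chi 2)) * jacobsthal (1 : F).
  have S1 (c : F) : \sum_x chi (x + c) = 0.
    by rewrite (sum_translate c (fun x => chi x)) sum_quad_char.
  have T1 : \sum_x chi (x - 1) * chi x * chi (x + 1) = jacobsthal (1 : F).
    by apply: (@sum_triple 0) => x; rewrite -!quad_charM; congr chi; ring.
  have T2 : \sum_x chi (x - 1) * chi x * chi (x + 2) = chi 2 * jacobsthal (1 : F).
    rewrite -jacobsthal4; apply: (@sum_triple 2) => x; rewrite -!quad_charM.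
    by congr chi; apply: (@eq_modF5 (- (x ^+ 2 + 2 * x))); ring.
  have T3 : \sum_x chi (x - 1) * chi (x + 1) * chi (x + 2) = chi 2 * jacobsthal (1 : F).
    rewrite -jacobsthal4; apply: (@sum_triple (-1)) => x; rewrite -!quad_charM.
    by congr chi; apply: (@eq_modF5 (x ^+ 2 - 1)); ring.
  have T4 : \sum_x chi x * chi (x + 1) * chi (x + 2) = jacobsthal (1 : F).
    by apply: (@sum_triple 1) => x; rewrite -!quad_charM; congr chi; ring.
  have D (a b : F) : a != b -> \sum_x chi (x + a) * chi (x + b) = -1.
    exact: sum_quad_char_pair.
  have D0 (b : F) : b != 0 -> \sum_x chi x * chi (x + b) = -1.
    move=> b0; rewrite -(D 0 b) 1?eq_sym //.
    by apply: eq_bigr => x _; rewrite addr0.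
  have D1 : \sum_x chi (x - 1) * chi x = -1.
    rewrite -(D0 (-1)) ?oppr_eq0 ?oner_eq0 //.
    by apply: eq_bigr => x _; rewrite mulrC.
  under eq_bigr do rewrite PE.
  rewrite !big_split /= -!mulr_sumr !big_split /= sumr_const natz.
  rewrite !S1 sum_quad_char T1 T2 T3 T4 sum_quartic D1 !D0 ?n1 ?n2 // !D.
  - ring.
  - by rewrite eq_sym -subr_eq0 (_ : 2 - 1 = 1) //; ring.
  - by rewrite eq_sym -subr_eq0 (_ : 2 - (-1) = 3) //; ring.
  - by rewrite eq_sym -subr_eq0 (_ : 1 - (-1) = 2) //; ring.
rewrite sumP; congr (_ - _).
have -> : P 1 = (1 + e) * (1 + e * chi 2) ^+ 2.
  rewrite /P subrr quad_char0 quad_char1 (_ : 1 + 1 = 2 :> F) //.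
  by rewrite (_ : 1 + 2 = 3 :> F) ?chi3; ring.
have -> : P 0 = (1 + e) ^+ 2 * (1 + e * chi 2).
  by rewrite /P sub0r !add0r quad_charN quad_char0 quad_char1; ring.
have -> : P (-1) = (1 + e) ^+ 2 * (1 + e * chi 2).
  rewrite /P addNr quad_char0 quad_charN (_ : -1 - 1 = - 2 :> F); last by ring.
  by rewrite chiN2 (_ : -1 + 2 = 1 :> F) ?quad_char1; ring.
have -> : P (-2) = (1 + e) * (1 + e * chi 2) ^+ 2.
  rewrite /P addNr quad_char0 chiN2 (_ : -2 - 1 = - 3 :> F); last by ring.
  by rewrite chiN3 (_ : -2 + 1 = -1 :> F) ?quad_charN ?quad_char1; ring.
ring.
Qed.

End QuadraticCharacter.

(** * Central binomial coefficients modulo 5 *)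

Lemma logn_fact_step (p a r : nat) : prime p -> (r < p)%N ->
  logn p (p * a + r)`! = (a + logn p a`!)%N.
Proof.
move=> p_pr; have p0 := prime_gt0 p_pr; elim: a r => [|a IHa] r.
  rewrite muln0 add0n fact0 logn1 addn0.
  elim: r => [|r IHr] rp; first by rewrite fact0 logn1.
  rewrite factS lognM ?fact_gt0 // IHr ?(ltnW rp) // addn0.
  by rewrite lognE p_pr /= gtnNdvd.
elim: r => [_|r IHr rp].
  have pE : (p * a.+1 + 0 = (p * a + p.-1).+1)%N by nia.
  rewrite pE factS -pE addn0 lognM ?fact_gt0 ?muln_gt0 ?p0 // lognM //.
  rewrite (logn_prime p p_pr) eqxx IHa ?ltn_predL // factS lognM ?fact_gt0 //.
  lia.
rewrite addnS factS lognM ?fact_gt0 // IHr ?(ltnW rp) //.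
rewrite lognE p_pr /= -addnS dvdn_addr ?dvdn_mulr //.
by rewrite gtnNdvd.
Qed.

(** In base 5 all digits of M are 1 and all digits of 2M are 2, so there is no
    carry in M + M: the 5-adic valuations of (2M)! and M!^2 agree, by removing
    one digit at a time. *)
Lemma central_bin_ndvd5 (d M : nat) : (5 ^ d = 4 * M + 1)%N ->
  ~~ (5 %| 'C(M.*2, M))%N.
Proof.
move=> dM; have MM : (M <= M.*2)%N by lia.
have : logn 5 M.*2`! = (logn 5 M`!).*2.
  elim: d M dM {MM} => [|d IHd] M dM.
    by have -> : M = 0%N by move: dM; rewrite expn0; lia.
  move: dM; rewrite expnS => dM.
  have [m mM] : exists m, M = (5 * m + 1)%N by exists (M %/ 5)%N; lia.
  have -> : M.*2 = (5 * m.*2 + 2)%N by lia.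
  rewrite mM !logn_fact_step // IHd; lia.
rewrite -(bin_fact MM) (_ : M.*2 - M = M)%N; last by lia.
rewrite !lognM ?muln_gt0 ?fact_gt0 ?bin_gt0 // => e.
have : logn 5 'C(M.*2, M) = 0%N by lia.
by move=> l0; apply/negP => d5; move: l0; rewrite lognE /= bin_gt0 MM d5.
Qed.

(** * Sums of two squares *)

(** By Brahmagupta's identity, (s u + t v)^2 + (s v - t u)^2 = q^2, so
    s v - t u is 0 or q up to sign. In the first case (s, t) and (u, v) are
    proportional; the second would give q = s^2 + u^2, which is even. *)
Lemma two_squares_uniq (q s t u v : int) :
  q = s ^+ 2 + t ^+ 2 -> q = u ^+ 2 + v ^+ 2 ->
  (s = 1 %[mod 4])%Z -> (u = 1 %[mod 4])%Z -> ~~ (2 %| q)%Z ->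
  (q %| s * v - t * u)%Z -> s ^+ 2 = u ^+ 2.
Proof.
move=> qst quv s4 u4 q2 /dvdzP[k kE].
have q0 : 0 < q.
  have : q != 0 by apply: contraNneq q2 => ->.
  by have := sqr_ge0 s; have := sqr_ge0 t; lia.
have brahmagupta : (s * u + t * v) ^+ 2 + (k * q) ^+ 2 = q ^+ 2.
  by rewrite -kE [in RHS]expr2 {1}qst quv; ring.
have k2 : k ^+ 2 <= 1.
  have : k ^+ 2 * q ^+ 2 <= 1 * q ^+ 2.
    by rewrite mul1r -exprMn -brahmagupta lerDr sqr_ge0.
  by rewrite ler_pM2r // exprn_gt0.
have [k0|k1] : k = 0 \/ k ^+ 2 = 1.
  by clear - k2; have [->|?] := eqVneq k 0; [left | right; nia].
  have stuv : s * v = t * u.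
    by apply/eqP; rewrite -subr_eq0 kE k0 mul0r.
  apply: (@mulIf _ q); first by rewrite gt_eqF.
  rewrite {1}quv qst mulrDr mulrDr -!exprMn stuv; ring.
have sutv : (s * u) ^+ 2 = (t * v) ^+ 2.
  have /eqP : (s * u + t * v) ^+ 2 = 0.
    by apply: (addIr (q ^+ 2)); rewrite add0r -[RHS]brahmagupta exprMn k1 mul1r.
  by rewrite sqrf_eq0 addr_eq0 => /eqP->; rewrite sqrrN.
have : q * (q - (s ^+ 2 + u ^+ 2)) = 0.
  have -> : q * (q - (s ^+ 2 + u ^+ 2)) = (q - s ^+ 2) * (q - u ^+ 2) - (s * u) ^+ 2.
    ring.
  by rewrite {1}qst quv sutv; ring.
move/eqP; rewrite mulf_eq0 gt_eqF //= subr_eq0 => /eqP qsu.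
have [a sa] : exists a, s = 4 * a + 1 by clear - s4; exists (s %/ 4)%Z; lia.
have [b ub] : exists b, u = 4 * b + 1 by clear - u4; exists (u %/ 4)%Z; lia.
case/negP: q2; apply/dvdzP; exists (8 * a ^+ 2 + 4 * a + 8 * b ^+ 2 + 4 * b + 1).
by rewrite qsu sa ub; ring.
Qed.

(** The product (s v - t u) (s v + t u) = q (s^2 - u^2) is divisible by 5^d.
    Both factors cannot be divisible by 5, since their sum is 2 s v; hence 5^d
    divides one of them. *)
Lemma s_spec_uniq (d : nat) (s u : int) : (0 < d)%N ->
  s_spec (5 ^ d) s -> s_spec (5 ^ d) u -> s = u.
Proof.
move=> d0 [[t st] s5 s4] [[v uv] u5 u4].
have euclid5 (a b : int) : (5 %| a * b)%Z = (5 %| a)%Z || (5 %| b)%Z.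
  by rewrite !dvdzE abszM Euclid_dvdM.
have q5 : (5 %| (5 ^ d)%N%:Z)%Z by rewrite dvdzE dvdn_exp.
have q2 : ~~ (2 %| (5 ^ d)%N%:Z)%Z by rewrite dvdzE dvdn2 negbK oddX orbT.
have v5 : ~~ (5 %| v)%Z.
  apply: contra u5 => v5; have : (5 %| u ^+ 2)%Z.
    have -> : u ^+ 2 = (5 ^ d)%N%:Z - v ^+ 2 by rewrite uv addrK.
    by rewrite rpredB // dvdz_mulr.
  by rewrite expr2 euclid5 orbb.
have qdvd : ((5 ^ d)%N %| (s * v - t * u) * (s * v - (- t) * u))%Z.
  apply/dvdzP; exists (s ^+ 2 - u ^+ 2).
  transitivity (s ^+ 2 * v ^+ 2 - t ^+ 2 * u ^+ 2); first by ring.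
  have -> : v ^+ 2 = (5 ^ d)%N%:Z - u ^+ 2 by rewrite uv addrC addKr.
  have -> : t ^+ 2 = (5 ^ d)%N%:Z - s ^+ 2 by rewrite st addrC addKr.
  ring.
have su : s ^+ 2 = u ^+ 2.
  have cop (a : int) : ~~ (5 %| a)%Z -> coprimez (5 ^ d)%N a.
    by rewrite dvdzE coprimezE => a5; rewrite coprimeXl // prime_coprime.
  case: (boolP (5 %| s * v - t * u)%Z) => [h|/cop h]; last first.
    apply: (two_squares_uniq (t := - t) _ uv s4 u4 q2); first by rewrite sqrrN.
    by rewrite -(Gauss_dvdzr _ h).
  have /cop h' : ~~ (5 %| s * v - (- t) * u)%Z.
    apply/negP => h'; have : (5 %| (2 * s) * v)%Z.
      have -> : 2 * s * v = (s * v - t * u) + (s * v - (- t) * u) by ring.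
      by rewrite rpredD.
    by rewrite !euclid5 (negbTE s5) (negbTE v5).
  apply: (two_squares_uniq st uv s4 u4 q2).
  by rewrite -(Gauss_dvdzl _ h').
have /eqP := su; rewrite eqf_sqr => /orP[/eqP //|/eqP suN].
by clear - s4 u4 suN; lia.
Qed.

(** * The two counts *)

(** The power 5^d modulo 8 depends on the parity of d. *)
Lemma pow5_form (d : nat) :
  exists2 M : nat, (5 ^ d = 4 * M + 1)%N & odd M = odd d.
Proof.
elim: d => [|d [M dM oM]]; first by exists 0%N.
exists (5 * M + 1)%N; first by rewrite expnS dM; lia.
by rewrite oddD oddM oM addbT.
Qed.

Lemma nonzero_squareE (F : finFieldType) (x : F) :
  nonzero_square x = (quad_char x == 1).
Proof.
rewrite /quad_char; have [->|_] := eqVneq x 0; last by case: ifP.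
apply/negbTE/existsP => -[b /andP[b0]].
by rewrite eq_sym expf_eq0 (negbTE b0).
Qed.

Lemma nonsquareE (F : finFieldType) (x : F) :
  nonsquare x = (quad_char x == -1).
Proof.
rewrite /quad_char /nonsquare; have [->|x0] := eqVneq x 0.
  by apply/negbTE; rewrite negbK; apply/existsP; exists 0; rewrite expr0n.
have -> : [exists b : F, x == b ^+ 2] = nonzero_square x.
  apply/existsP/existsP => [[b /eqP xb]|[b /andP[_ xb]]]; exists b => //.
  by rewrite xb eqxx andbT; apply: contraNneq x0 => b0; rewrite xb b0 expr0n.
by case: ifP.
Qed.

Lemma jacobsthal1_s_spec (F : finFieldType) (d : nat) : (0 < d)%N ->
  #|F| = (5 ^ d)%N ->
  exists2 s : int, s_spec (5 ^ d) s & jacobsthal (1 : F) = 2 * ((-1) ^+ d.+1 * s).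
Proof.
move=> d0 cF; have [M dM oM] := pow5_form d.
have cardF : #|F| = (M.*2).*2.+1 by lia.
have char5 : 5%:R = 0 :> F.
  have : 5 \in [pchar F] by apply: card_finPcharP cF _.
  by rewrite inE => /andP[_ /eqP].
have [k Jk] := jacobsthal1_mod8 cardF char5.
have [g gP] := finField_prim_root F.
have := jacobsthal_sum_two_squares cardF (quad_charN1 cardF char5)
  (quad_char_generator cardF gP).
have : ~~ (5 %| jacobsthal (1%R : F))%Z.
  apply: contra (central_bin_ndvd5 dM) => /dvdzP[z zE].
  have p5 : 5 \in [pchar F] by rewrite inE char5 eqxx.
  rewrite (dvdn_pcharf p5).
  have := jacobsthal1_natr cardF erefl; rewrite zE intrM.
  rewrite [5%:~R](char5 : (5 : int)%:~R = 0 :> F) mulr0.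
  move/eqP; rewrite eq_sym oppr_eq0 mulf_eq0 expf_eq0 oppr_eq0 oner_eq0 andbF.
  by [].
move: Jk; move: (jacobsthal g) (jacobsthal (1 : F)) => T J Jk J5 JT.
pose e : int := 2 * M%:Z - 1 - 4 * k%:Z.
have Je : J = 2 * e by rewrite Jk cF dM /e; lia.
have eT : e ^+ 2 + (T %/ 2)%Z ^+ 2 = (5 ^ d)%N%:Z.
  have [t [Tt|Tt]] : exists t, T = 2 * t \/ T = 2 * t + 1.
  - by exists (T %/ 2)%Z; lia.
  - have -> : (T %/ 2)%Z = t by lia.
    by move: JT; rewrite Je Tt cF; clear; lia.
  - by move: JT; rewrite Je Tt cF; clear; lia.
(* The sign makes the odd integer e congruent to 1 modulo 4. *)
exists ((-1) ^+ d.+1 * e); last by rewrite signrMK.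
split.
- by exists (T %/ 2)%Z; rewrite exprMn sqrr_sign mul1r.
- apply: contra J5 => /dvdzP[z zE]; apply/dvdzP; exists (2 * (-1) ^+ d.+1 * z).
  by rewrite Je -!mulrA -zE signrMK.
- rewrite -signr_odd /= -oM /e; case: (boolP (odd M)) => o; rewrite ?expr1 ?expr0; lia.
Qed.

Theorem theorem1p2 (d q : nat) (hd : (1 <= d)%N) (hq : q = (5 ^ d)%N)
    (F : finFieldType) (hF : #|F| = q) :
  (exists! s : int, s_spec q s) /\
  (forall s : int, s_spec q s ->
    (~~ odd d ->
       (m_ F)%:R = (q%:R - 10 * s%:~R - 39) / 16 :> rat /\
       (n_ F)%:R = (q%:R + 6 * s%:~R - 7) / 16 :> rat) /\
    (odd d ->
       (m_ F)%:R = (q%:R + 2 * s%:~R - 7) / 16 :> rat /\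
       (n_ F)%:R = (q%:R + 2 * s%:~R - 7) / 16 :> rat)).
Proof.
subst q; have [s0 s0P Js0] := jacobsthal1_s_spec hd hF.
split; first by exists s0; split => // u; apply: s_spec_uniq.
move=> s /(s_spec_uniq hd s0P) <-{s}.
have [M dM oM] := pow5_form d.
have cardF : #|F| = (M.*2).*2.+1 by rewrite hF; lia.
have char5 : 5%:R = 0 :> F.
  have : 5 \in [pchar F] by apply: card_finPcharP hF _.
  by rewrite inE => /andP[_ /eqP].
have count (e : int) : e \in [:: 1; -1] -> _ := count_quadruples cardF char5 (e := e).
have mE : m_ F = #|[set a : F | [&& quad_char (a - 1)%R == 1, quad_char a == 1,
    quad_char (a + 1)%R == 1 & quad_char (a + 2)%R == 1]]|.
  by apply: eq_card => a; rewrite !inE !nonzero_squareE.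
have nE : n_ F = #|[set a : F | [&& quad_char (a - 1)%R == -1, quad_char a == -1,
    quad_char (a + 1)%R == -1 & quad_char (a + 2)%R == -1]]|.
  by apply: eq_card => a; rewrite !inE !nonsquareE.
have := count 1 isT; have := count (-1) isT; rewrite -mE -nE {count}.
rewrite (quad_char2 cardF char5 erefl) Js0 hF exprS.
rewrite -[(-1) ^+ M]signr_odd oM -[(-1) ^+ d]signr_odd.
have castZ (m : nat) (z : int) : 16 * m%:Z = z -> m%:R = z%:~R / 16 :> rat.
  move=> mz; apply: (@mulIf _ 16) => //; rewrite divfK // -mz.
  by rewrite rmorphM /= mulrC pmulrn.
have castq : (5 ^ d)%:R = ((5 ^ d)%N%:Z)%:~R :> rat by [].
move: (5 ^ d)%N castq => q castq nq mq.
split=> od; move: nq mq; rewrite ?(negbTE od) ?od => nq mq; split.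
- rewrite (castZ (m_ F) (q%:Z - 10 * s0 - 39)); first by rewrite castq; field.
  rewrite mq; ring.
- rewrite (castZ (n_ F) (q%:Z + 6 * s0 - 7)); first by rewrite castq; field.
  rewrite nq; ring.
- rewrite (castZ (m_ F) (q%:Z + 2 * s0 - 7)); first by rewrite castq; field.
  rewrite mq; ring.
- rewrite (castZ (n_ F) (q%:Z + 2 * s0 - 7)); first by rewrite castq; field.
  rewrite nq; ring.
Qed.
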